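(* Let $G$ and $G'$ be finitely generated Abelian groups of non-zero rank. Then the following are equivalent: (i) $G$ and $G'$ admit equal growth functions (with respect to monoid generating sets), i.e., there exist a finite monoid generating set $S \subset G$ of $G$ and a finite monoid generating set $S' \subset G'$ of $G'$ such that $\beta_{G,S}(r) = \beta_{G',S'}(r)$ for all $r \in \mathbb{N}$; (ii) $\operatorname{rk} G = \operatorname{rk} G'$.
   Context: $\mathbb{N}$ contains $0$. For a finitely generated group $G$ with neutral element $e$ and a finite monoid generating set $S \subset G$ (not necessarily symmetric; every element of $G$ is a finite, possibly empty, product of elements of $S$), define $d_S(g,h) := \min\{ n \in \mathbb{N} \mid \exists s_1,\dots,s_n \in S : h^{-1} g = s_1 \cdots s_n\}$ for $g,h \in G$. The ball of radius $r \in \mathbb{N}$ is $B_{G,S}(r) := \{ g \in G \mid d_S(g,e) \le r\}$, and the growth function of $G$ with respect to $S$ is $\beta_{G,S} \colon \mathbb{N} \to \mathbb{N}$, $\beta_{G,S}(r) := |B_{G,S}(r)|$. For a finitely generated Abelian group $G$, $\operatorname{tors} G$ denotes the (finite) subgroup of all elements of finite order, and $\operatorname{rk} G$ denotes the rank of the free Abelian group $G/\operatorname{tors} G$. *)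

(* Defs.v *)
(* Abelian groups are written additively: an Abelian group is a [zmodType], the
   neutral element is 0 and h^-1 g becomes g - h. *)
From HB Require Import structures.
From mathcomp Require Import all_boot all_order all_algebra.
From mathcomp Require Import finmap boolp classical_sets cardinality.
From mathcomp Require Import ring zify.

Set Implicit Arguments.
Unset Strict Implicit.
Unset Printing Implicit Defensive.

Import Order.TTheory GRing.Theory Num.Theory.
Local Open Scope classical_set_scope.
Local Open Scope quotient_scope.
Local Open Scope ring_scope.

Definition finitely_generated (G : zmodType) : Prop :=
  exists (n : nat) (x : 'I_n -> G),
    forall g : G, exists c : 'I_n -> int, g = \sum_(i < n) x i *~ c i.

Section Growth.
Variables (G : zmodType) (S : {fset G}).

Definition is_word_sum (n : nat) (g : G) : Prop :=
  exists s : n.-tuple G, {subset s <= S} /\ g = \sum_(x <- s) x.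

Definition monoid_generating : Prop := forall g : G, exists n, is_word_sum n g.

Hypothesis genS : monoid_generating.

Lemma word_length_ex (g h : G) : exists n : nat, `[< is_word_sum n (g - h) >].
Proof. by have [n gn] := genS (g - h); exists n; apply/asboolP. Qed.

Definition word_dist (g h : G) : nat := ex_minn (word_length_ex g h).

Definition ball (r : nat) : set G := [set g | (word_dist g 0 <= r)%N].

Lemma finite_ball (r : nat) : finite_set (ball r).
Proof.
have fin_words : finite_set (\bigcup_(n in `I_r.+1) [set g | is_word_sum n g]).
  apply: bigcup_finite; first exact: finite_II.
  move=> n _; pose f (t : n.-tuple S) : G := \sum_(x <- t) fsval x.
  apply: (@sub_finite_set _ _ (range f)); last first.
    by apply: finite_image; apply: finite_finset.
  move=> g [s [sS ->]]; have sS' := allP (introT allP sS).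
  pose t := pmap (insub : G -> option S) s.
  have tE : map (fun x : S => fsval x) t = s.
    rewrite /t (pmap_filter (@insubK _ _ S)); apply/all_filterP/allP => x xs.
    by rewrite isSome_insub sS'.
  have st : size t == n by rewrite -(size_map (fun x : S => fsval x)) tE size_tuple.
  by exists (Tuple st) => //; rewrite /f -(big_map _ xpredT idfun) /= tE.
apply: sub_finite_set fin_words => g; rewrite /ball /= /word_dist.
by case: ex_minnP => n /asboolP; rewrite subr0 => gn _ nr; exists n.
Qed.

(* [fset_set] sends infinite sets to the empty set, but balls are finite by
   [finite_ball]. *)
Definition growth (r : nat) : nat := #|` fset_set (ball r)|.

End Growth.

Section Torsion.
Variable G : zmodType.

Definition tors : {pred G} :=
  fun g => `[< exists n : nat, (0 < n)%N /\ g *+ n = 0 >].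

Lemma tors_zmod_closed : zmod_closed tors.
Proof.
split=> [|g h /asboolP[m [m0 gm]] /asboolP[n [n0 hn]]]; apply/asboolP.
  by exists 1%N.
exists (m * n)%N; rewrite muln_gt0 m0 n0; split=> //.
by rewrite mulrnBl mulrnA gm mul0rn [(m * n)%N]mulnC mulrnA hn mul0rn subr0.
Qed.

HB.instance Definition _ := GRing.isZmodClosed.Build G tors tors_zmod_closed.

Definition torsion_free_quotient : zmodType := Quotient.quot tors.

End Torsion.

Definition is_zbasis (A : zmodType) (n : nat) (b : 'I_n -> A) : Prop :=
  forall a : A, exists! c : {ffun 'I_n -> int}, a = \sum_(i < n) b i *~ c i.

(* [xget] picks an n such that G / tors G has a Z-basis of cardinality n (0 if
   there is none). For G finitely generated there is exactly one such n: see
   [rk_zbasis] and [zbasis_card]. *)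
Definition rk (G : zmodType) : nat :=
  xget 0%N [set n : nat | exists b : 'I_n -> torsion_free_quotient G, is_zbasis b].

Lemma zbasis_card_le (A : zmodType) (m n : nat) (a : 'I_m -> A) (b : 'I_n -> A) :
  is_zbasis a -> is_zbasis b -> (m <= n)%N.
Proof.
move=> aB bB.
have /choice[P PE] i : exists c : {ffun 'I_n -> int}, a i = \sum_j b j *~ c j.
  by have [c [cE _]] := bB (a i); exists c.
have /choice[Q QE] j : exists c : {ffun 'I_m -> int}, b j = \sum_i a i *~ c i.
  by have [c [cE _]] := aB (b j); exists c.
apply: (@mulmx1_min _ m n (\matrix_(i, j) P i j) (\matrix_(j, i) Q j i)).
apply/matrixP => i k; rewrite !mxE; under eq_bigr do rewrite !mxE.
have [c [_ c_uniq]] := aB (a i).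
pose d : {ffun 'I_m -> int} := [ffun k => (i == k)%:R].
pose e : {ffun 'I_m -> int} := [ffun k => \sum_j P i j * Q j k].
have dE : c = d.
  apply: c_uniq; rewrite (bigD1 i)//= big1 ?addr0 => [|l li].
    by rewrite ffunE eqxx.
  by rewrite ffunE eq_sym (negPf li).
have eE : c = e.
  apply: c_uniq; rewrite {1}PE.
  under eq_bigr do rewrite QE mulrz_suml.
  rewrite exchange_big; apply: eq_bigr => l _ /=.
  rewrite ffunE mulrz_sumr; apply: eq_bigr => j _.
  by rewrite -mulrzA mulrC.
by have := congr1 (fun f : {ffun 'I_m -> int} => f k) (etrans (esym eE) dE);
  rewrite !ffunE.
Qed.

Lemma zbasis_card (A : zmodType) (m n : nat) (a : 'I_m -> A) (b : 'I_n -> A) :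
  is_zbasis a -> is_zbasis b -> m = n.
Proof.
by move=> aB bB; apply/eqP; rewrite eqn_leq !(zbasis_card_le aB bB, zbasis_card_le bB aB).
Qed.

Lemma fg_torsion_free_zbasis (A : zmodType) :
    (forall (a : A) (n : nat), (0 < n)%N -> a *+ n = 0 -> a = 0) ->
    finitely_generated A ->
  exists (n : nat) (b : 'I_n -> A), is_zbasis b.
Proof.
move=> tfA fgA.
pose gen n (x : 'I_n -> A) :=
  forall a, exists c : 'I_n -> int, a = \sum_(i < n) x i *~ c i.
have : exists n, `[< exists x : 'I_n -> A, gen n x >].
  by have [n [x xg]] := fgA; exists n; apply/asboolP; exists x.
case/ex_minnP => n /asboolP[b bg] n_min; exists n, b.
have tfz (a : A) (z : int) : z != 0 -> a *~ z = 0 -> a = 0.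
  case: z => [k|k] k0.
    by move/tfA; apply; case: k k0.
  by rewrite NegzE mulrNz => /eqP; rewrite oppr_eq0 => /eqP/tfA; apply.
have indep k : forall (x : 'I_n -> A) (c : 'I_n -> int), gen n x ->
    (\sum_i `|c i|%N <= k)%N -> \sum_i x i *~ c i = 0 -> forall i, c i = 0.
  elim: k => [|k IHk] x c xg ck xc0.
    move=> i; apply/eqP; rewrite -absz_eq0 -leqn0 (leq_trans _ ck)//.
    by rewrite (bigD1 i)//= leq_addr.
  move=> i0; apply/eqP; apply: contraT => ci0.
  pose i := [arg max_(i > i0) `|c i|%N].
  have i_max j : (`|c j| <= `|c i|)%N by rewrite /i; case: arg_maxnP => // ? _; exact.
  have ci : c i != 0 by rewrite -absz_eq0 -lt0n (leq_trans _ (i_max i0))// lt0n absz_eq0.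
  have [/existsP[j /andP[ji cj]]|/existsPn only_i] :=
      boolP [exists j, (j != i) && (c j != 0)].
    have [e eE] : exists e : int, (absz (c i - e * c j)%R < absz (c i))%N.
      have := i_max j; move: ci cj => /eqP ci /eqP cj cij.
      exists (if (0 <= c i) == (0 <= c j) then 1 else -1).
      by case: eqP; lia.
    pose x' l := if l == j then x j + x i *~ e else x l.
    pose f (d : 'I_n -> int) l := if l == i then d i - e * d j else d l.
    have xf d : \sum_l x' l *~ f d l = \sum_l x l *~ d l.
      rewrite (bigD1 i)//= (bigD1 j)//= [in RHS](bigD1 i)//= [in RHS](bigD1 j)//=.
      rewrite !addrA; congr (_ + _); last first.
        by apply: eq_bigr => l /andP[/negPf li /negPf lj]; rewrite /x' /f li lj.
      rewrite /x' /f !eqxx (negPf ji) eq_sym (negPf ji).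
      rewrite mulrzBr mulrzDl -mulrzA -!addrA; congr (_ + _).
      by rewrite addrCA addNr addr0.
    have x'g : gen n x'.
      by move=> a; have [d ->] := xg a; exists (f d); rewrite xf.
    have fc : (\sum_l `|f c l|%N <= k)%N.
      rewrite -ltnS (leq_trans _ ck)// (bigD1 i)//= [in X in (_ < X)%N](bigD1 i)//=.
      rewrite {1}/f eqxx -addSn leq_add// leq_sum// => l /negPf li.
      by rewrite /f li.
    have := IHk x' (f c) x'g fc (etrans (xf c) xc0) j.
    by rewrite /f (negPf ji) => cj0; rewrite cj0 eqxx in cj.
  have c0 j : j != i -> c j = 0.
    by move=> ji; apply/eqP; have := only_i j; rewrite ji /= negbK.
  have xi0 : x i = 0.
    apply: (tfz _ _ ci); rewrite -[RHS]xc0 (bigD1 i)//= big1 ?addr0// => j ji.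
    by rewrite c0.
  clearbody i; clear i_max IHk ck xc0 i0 ci0 ci only_i c0 bg b.
  case: n i x c xg xi0 n_min
    => [[]//|m] i x c xg xi0 n_min.
  have := n_min m; rewrite ltnn => -> //; apply/asboolP.
  exists (fun l => x (lift i l)) => a; have [d ->] := xg a.
  exists (fun l => d (lift i l)).
  by rewrite (bigD1_ord i)//= xi0 mul0rz add0r.
move=> a; have [c aE] := bg a.
exists (finfun c); split=> [|d dE]; first by rewrite aE; under [RHS]eq_bigr do rewrite ffunE.
apply/ffunP => i; rewrite ffunE; apply/eqP; rewrite -subr_eq0; apply/eqP; move: i.
apply: (indep _ b (fun i => c i - d i) bg (leqnn _)).
under eq_bigr do rewrite mulrzBr.
by rewrite sumrB -aE -dE subrr.
Qed.

Lemma rk_zbasis (G : zmodType) : finitely_generated G ->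
  exists b : 'I_(rk G) -> torsion_free_quotient G, is_zbasis b.
Proof.
move=> [n [x xg]]; rewrite /rk; case: xgetP => // nobasis; exfalso.
pose Q := Quotient.quot (@tors G).
have [m [b bB]] : exists (m : nat) (b : 'I_m -> torsion_free_quotient G), is_zbasis b.
  apply: fg_torsion_free_zbasis; last first.
    exists n, (fun i => \pi_Q (x i)) => q; have [c cE] := xg (repr q); exists c.
    rewrite -[LHS](reprK (q : Q)) cE raddf_sum; apply: eq_bigr => i _.
    by rewrite raddfMz.
  move=> q k k0; rewrite -[q](reprK (q : Q)) -raddfMn /=.
  have pi0 g : (\pi_Q g = 0) <-> g \in @tors G.
    rewrite -[g in g \in _]subr0 Quotient.idealrBE.
    by rewrite -(raddf0 (\pi_Q)); split=> [->|/eqP].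
  move/pi0 => /asboolP[l [l0]]; rewrite -mulrnA => ql; apply/pi0/asboolP.
  by exists (k * l)%N; rewrite muln_gt0 k0.
by case: (nobasis m); exists b.
Qed.

(* Main.v *)
Require Import Defs.
From HB Require Import structures.
From mathcomp Require Import all_boot all_order all_algebra.
From mathcomp Require Import finmap.
From mathcomp Require Import boolp classical_sets cardinality zify.

(** A finitely generated Abelian group of rank d splits as Z^d x T with T finite
([fg_splitting]), and both directions are read off from this splitting.

Equal growth forces equal rank, because the growth function of Z^d x T has
order r^d for every generating set. A word of length r has coordinates of size
O(r), which leaves O(r^d) values ([growth_upper]). Conversely, each basis vector
is a word of some fixed length, so r.+1 ^ d distinct sums of basis vectors are
words of length O(r) ([growth_lower]). A polynomial upper bound of
smaller degree cannot dominate such a lower bound ([growth_rank_le]).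

For equal ranks d = n.+1, let t and t' be the orders of the two torsion groups.
The point is that a suitable generating set makes Z^d x T look like Z^d itself.
Numbering T by 0, ..., t - 1 with the neutral element first, the map
(a, k) |-> a t + k is a bijection from Z x T to Z; applied to the first
coordinate it gives a bijection [carry] from Z^d x T to Z^d. It is not a
homomorphism, but for every m > 0 the preimages of the boxes
[-t m r, t m r] x [-r, r]^n are still the sums of r copies of the preimage S for
r = 1 ([box_carryS]). Indeed |a t + k| <= t m r describes the set
[-m r, m r - 1] x T together with the single element (m r, 0), and these sets
add up: the only sum with first coordinate m (r + 1) is that of the two extreme
elements, both with trivial torsion part. Hence the ball of radius r for S has
as many elements as the box, a number that depends on the product t m only
([box_growth]). Taking m = t' for the first group and m = t for the second gives
the same product t t', hence equal growth functions. *)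

Set Implicit Arguments.
Unset Strict Implicit.
Unset Printing Implicit Defensive.

Import Order.TTheory GRing.Theory Num.Theory.
Local Open Scope classical_set_scope.
Local Open Scope quotient_scope.
Local Open Scope ring_scope.

(** * Words and balls *)

Lemma is_word_sum0 (G : zmodType) (S : {fset G}) (g : G) :
  is_word_sum S 0 g <-> g = 0.
Proof.
split=> [[s [_ ->]]|->]; first by rewrite (tuple0 s) big_nil.
by exists [tuple]; rewrite big_nil; split.
Qed.

Lemma is_word_sumS (G : zmodType) (S : {fset G}) (n : nat) (g : G) :
  is_word_sum S n.+1 g <->
  exists s h, [/\ s \in S, is_word_sum S n h & g = s + h].
Proof.
split=> [[s [sS ->]]|[x [h [xS [s [sS ->]] ->]]]].
  case/tupleP: s sS => x s sS; exists x, (\sum_(y <- s) y); split.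
  - by apply: sS; rewrite inE eqxx.
  - by exists s; split=> // y ys; apply: sS; rewrite inE ys orbT.
  - by rewrite big_cons.
exists [tuple of x :: s]; split; last by rewrite big_cons.
by move=> y; rewrite inE => /predU1P[->//|/sS].
Qed.

Lemma is_word_sumD (G : zmodType) (S : {fset G}) (m n : nat) (g h : G) :
  is_word_sum S m g -> is_word_sum S n h -> is_word_sum S (m + n) (g + h).
Proof.
move=> [s [sS ->]] [t [tS ->]]; exists [tuple of s ++ t]; rewrite big_cat.
by split=> // x; rewrite mem_cat => /orP[/sS|/tS].
Qed.

Lemma is_word_sumMn (G : zmodType) (S : {fset G}) (n k : nat) (g : G) :
  is_word_sum S n g -> is_word_sum S (n * k) (g *+ k).
Proof.
move=> gn; elim: k => [|k IHk]; first by rewrite muln0 mulr0n; apply/is_word_sum0.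
by rewrite mulnS mulrS; apply: is_word_sumD.
Qed.

Lemma ballP (G : zmodType) (S : {fset G}) (genS : monoid_generating S)
    (r : nat) (g : G) :
  ball genS r g <-> exists2 n, (n <= r)%N & is_word_sum S n g.
Proof.
rewrite /ball /= /word_dist; case: ex_minnP => n /asboolP; rewrite subr0 => gn n_min.
split=> [nr|[m mr gm]]; first by exists n.
by apply: leq_trans mr; apply: n_min; apply/asboolP.
Qed.

(** * Splitting off the torsion *)

(** A decomposition of G as Z^d x T with T finite: [sect] embeds Z^d, and T is the
kernel of [proj], enumerated by [ker]. Listing 0 first lets the trivial torsion
part have number 0 in [carry]. *)
Record splitting (G : zmodType) (d : nat) : Type := Splitting {
  proj : {additive G -> 'rV[int]_d};
  sect : {additive 'rV[int]_d -> G};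
  sectK : cancel sect proj;
  ker : seq G;
  ker_uniq : uniq ker;
  mem_ker : forall g, (g \in ker) = (proj g == 0);
  ker_nth0 : nth 0 ker 0 = 0
}.

(** Gives an additive structure to maps that only arise inside a proof, such as those
obtained by choice. *)
Lemma additive_pack (A B : zmodType) (f : A -> B) :
  {morph f : x y / x - y} -> {f' : {additive A -> B} | f' =1 f}.
Proof.
move=> fB.
pose fM := GRing.isZmodMorphism.Build A B f fB.
pose f' : {additive A -> B} := HB.pack f fM.
by exists f'.
Qed.

Lemma pi_tors_eq0 (G : zmodType) (g : G) :
  (\pi_(Quotient.quot (@tors G)) g = 0) <-> g \in @tors G.
Proof.
rewrite -[g in g \in _]subr0 Quotient.idealrBE.
by rewrite -(raddf0 (\pi_(Quotient.quot (@tors G)))); split=> [->|/eqP].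
Qed.

(** Uniqueness of the coordinates in a Z-basis makes them additive. *)
Lemma zbasis_coord (A : zmodType) (n : nat) (b : 'I_n -> A) : is_zbasis b ->
  exists c : {additive A -> 'rV[int]_n},
    (forall a, a = \sum_i b i *~ c a 0 i) /\
    (forall v : 'rV[int]_n, c (\sum_i b i *~ v 0 i) = v).
Proof.
move=> bB.
have /choice[c cE] a : exists v : 'rV[int]_n, a = \sum_i b i *~ v 0 i.
  have [v [vE _]] := bB a; exists (\row_i v i).
  by rewrite vE; apply: eq_bigr => i _; rewrite mxE.
have cK (v : 'rV[int]_n) : c (\sum_i b i *~ v 0 i) = v.
  have [w [_ w_uniq]] := bB (\sum_i b i *~ v 0 i).
  have wE (u : 'rV[int]_n) :
      \sum_i b i *~ v 0 i = \sum_i b i *~ u 0 i -> w = [ffun i => u 0 i].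
    by move=> uE; apply: w_uniq; rewrite uE; apply: eq_bigr => i _; rewrite ffunE.
  apply/rowP => i.
  have := congr1 (fun f : {ffun 'I_n -> int} => f i)
    (etrans (esym (wE _ (cE _))) (wE _ erefl)).
  by rewrite !ffunE.
have [c' c'E] : {c' : {additive A -> 'rV[int]_n} | c' =1 c}.
  apply: additive_pack => x y; rewrite -[RHS]cK; congr c.
  rewrite {1}(cE x) {1}(cE y) -sumrB; apply: eq_bigr => i _.
  by rewrite !mxE mulrzBr.
by exists c'; split=> [a|v]; rewrite c'E.
Qed.

(** A torsion image of a finitely generated Abelian group is finite: if M kills the
images of all generators, coefficients matter only modulo M. *)
Lemma fg_torsion_finite (G T : zmodType) (tau : {additive G -> T}) :
  finitely_generated G -> (forall g, tau g \in @tors T) ->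
  finite_set (range tau).
Proof.
move=> [n [x xg]] tau_tors.
have /choice[N NP] i : exists N, (0 < N)%N /\ tau (x i) *+ N = 0.
  by have /asboolP := tau_tors (x i).
pose M := (\prod_i N i)%N.
have M0 : (0 < M)%N by apply: prodn_gt0 => i; have [] := NP i.
have xM i : tau (x i) *+ M = 0.
  by rewrite /M (bigD1 i)//= mulrnA (NP i).2 mul0rn.
pose f (k : {ffun 'I_n -> 'I_M}) : T := \sum_i tau (x i) *+ k i.
apply: (@sub_finite_set _ _ (range f)); last first.
  by apply: finite_image; apply: finite_finset.
move=> _ [g _ <-]; have [c ->] := xg g.
have modM i : (`|(c i %% M)%Z| < M)%N by lia.
exists [ffun i => Ordinal (modM i)] => //.
rewrite /f raddf_sum; apply: eq_bigr => i _; rewrite ffunE raddfMz /=.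
rewrite [in RHS](divz_eq (c i) M) mulrzDr mulrC mulrzA.
rewrite -[tau (x i) *~ Posz M]/(tau (x i) *+ M) xM mul0rz add0r.
by rewrite -[_ *+ `|_|]/(_ *~ Posz `|_|) gez0_abs//; lia.
Qed.

(** The quotient by the torsion has a Z-basis; representatives of it define the
section. The kernel of the projection is the torsion subgroup, which is finite
as the image of G under g |-> g - sect (proj g). *)
Lemma fg_splitting (G : zmodType) : finitely_generated G ->
  inhabited (splitting G (rk G)).
Proof.
move=> fgG; have [b bB] := rk_zbasis fgG.
have [c [cE cK]] := zbasis_coord bB.
pose pi : {additive G -> torsion_free_quotient G} := \pi_(Quotient.quot (@tors G)).
have piK q : pi (repr q) = q by exact: (@reprK G (Quotient.quot (@tors G))).
have [p pE] : {p : {additive G -> 'rV[int]_(rk G)} | p =1 c \o pi}.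
  by apply: additive_pack => x y; rewrite /= !raddfB.
have [s sE] : {s : {additive 'rV[int]_(rk G) -> G} |
    s =1 fun v => \sum_i repr (b i) *~ v 0 i}.
  apply: additive_pack => u v; rewrite -sumrB; apply: eq_bigr => i _.
  by rewrite !mxE mulrzBr.
have sK : cancel s p.
  move=> v; rewrite pE sE /= raddf_sum -[RHS]cK; congr (c _).
  by apply: eq_bigr => i _; rewrite raddfMz piK.
have [tau tauE] : {tau : {additive G -> G} | tau =1 fun g => g - s (p g)}.
  by apply: additive_pack => x y; rewrite !raddfB addrACA.
have p_tors g : p g = 0 -> g \in @tors G.
  rewrite pE /= => pg0; apply/pi_tors_eq0; rewrite -/(pi g) (cE (pi g)) pg0.
  by rewrite big1// => i _; rewrite mxE.
have kerE : [set g | p g = 0] = range tau.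
  apply/seteqP; split=> [g /= pg0|_ [g _ <-]] /=.
    by exists g => //; rewrite tauE pg0 raddf0 subr0.
  by rewrite tauE raddfB sK subrr.
have fin_ker : finite_set [set g | p g = 0].
  rewrite kerE; apply: fg_torsion_finite fgG _ => g; apply: p_tors.
  by rewrite tauE raddfB sK subrr.
pose k := (fset_set [set g | p g = 0] `\ 0)%fset.
constructor; apply: (@Splitting G (rk G) p s sK (0 :: k)) => //.
  by rewrite /= fset_uniq andbT !inE eqxx.
move=> g; rewrite inE in_fsetD1 in_fset_set//.
have [->|g0] := eqVneq; first by rewrite raddf0 eqxx.
by apply/idP/eqP; rewrite in_setE.
Qed.

Definition tors_part (G : zmodType) (d : nat) (sp : splitting G d) (g : G) : G :=
  g - sect sp (proj sp g).

Lemma tors_part_ker (G : zmodType) (d : nat) (sp : splitting G d) (g : G) :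
  tors_part sp g \in ker sp.
Proof. by rewrite mem_ker raddfB sectK subrr. Qed.

Lemma tors_partD (G : zmodType) (d : nat) (sp : splitting G d) :
  {morph tors_part sp : g h / g + h}.
Proof. by move=> g h; rewrite /tors_part !raddfD addrACA. Qed.

(** * The growth function determines the rank *)

Lemma leq_expl (m n e : nat) : (m <= n -> m ^ e <= n ^ e)%N.
Proof. by case: e => // e mn; rewrite leq_exp2r. Qed.

Lemma proj_word_sum_le (G : zmodType) (d : nat) (sp : splitting G d)
    (S : {fset G}) :
  exists M, forall n g, is_word_sum S n g ->
    forall i, (`|(proj sp g 0 i)%R| <= M * n)%N.
Proof.
exists (\sum_(s <- S) \sum_i `|(proj sp s 0 i)%R|)%N => n g + i.
elim: n g => [|n IHn] g.
  by move/is_word_sum0 => ->; rewrite raddf0 mxE.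
move/is_word_sumS => [s [h [sS hn ->]]]; rewrite raddfD mxE mulnS.
apply: leq_trans (_ : `|(proj sp s 0 i)%R| + `|(proj sp h 0 i)%R| <= _)%N; first by lia.
apply: leq_add; last exact: IHn.
rewrite (big_rem s)//= (bigD1 i)//= -addnA; exact: leq_addr.
Qed.

(** An element is determined by its torsion part and its d integer coordinates, and
on the ball of radius r each coordinate lies in an interval [-M r, M r]. *)
Lemma growth_upper (G : zmodType) (d : nat) (sp : splitting G d) (S : {fset G})
    (genS : monoid_generating S) :
  exists C, forall r, (growth genS r <= C * r.+1 ^ d)%N.
Proof.
have [M projM] := proj_word_sum_le sp S.
exists (size (ker sp) * (2 * M).+1 ^ d)%N => r.
pose I := ('I_(size (ker sp)) * {ffun 'I_d -> 'I_(2 * M * r).+1})%type.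
(* Coordinates are shifted by M r to be indexed by an ordinal. *)
pose f (x : I) : G :=
  sect sp (\row_i (Posz (x.2 i) - Posz (M * r))) + nth 0 (ker sp) x.1.
have ball_sub : (fset_set (ball genS r) `<=` [fset f x | x : I])%fset.
  apply/fsubsetP => g; rewrite in_fset_set ?in_setE; last exact: finite_ball.
  move=> /ballP[n nr /projM gM].
  have gMr i : (`|(proj sp g 0 i)%R| <= M * r)%N.
    by apply: leq_trans (gM i) _; rewrite leq_mul2l nr orbT.
  have idx : (index (tors_part sp g) (ker sp) < size (ker sp))%N.
    by rewrite index_mem tors_part_ker.
  have shift i : (`|(proj sp g 0 i + Posz (M * r))%R| < (2 * M * r).+1)%N.
    by have := gMr i; lia.
  apply/imfsetP; exists (Ordinal idx, [ffun i => Ordinal (shift i)]) => //.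
  rewrite /f /= nth_index ?tors_part_ker// addrC; apply/esym.
  rewrite -[RHS](subrK (sect sp (proj sp g))); congr (_ + sect sp _).
  apply/rowP => i; rewrite mxE ffunE /=; have := gMr i.
  by move: (proj sp g 0 i) (M * r)%N => z N; lia.
apply: leq_trans (fsubset_leq_card ball_sub) _.
apply: leq_trans (leq_imfset_card _ _ _) _.
rewrite -cardE card_prod card_ffun !card_ord -[in leqRHS]mulnA leq_mul2l -expnMn.
by apply/orP; right; apply: leq_expl; lia.
Qed.

(** Each basis vector is a word of some length l i, so the r.+1 ^ d distinct sums of
basis vectors with coefficients at most r are words of length at most
(\sum_i l i) * r. *)
Lemma growth_lower (G : zmodType) (d : nat) (sp : splitting G d) (S : {fset G})
    (genS : monoid_generating S) :
  exists L, forall r, (r.+1 ^ d <= growth genS (L * r))%N.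
Proof.
pose x i : G := sect sp (delta_mx 0 i).
have /choice[l xl] i : exists l, is_word_sum S l (x i) by exact: genS.
exists (\sum_i l i)%N => r.
pose f (k : {ffun 'I_d -> 'I_r.+1}) : G := \sum_i x i *+ k i.
have f_inj : injective f.
  move=> k k' /(congr1 (proj sp)) kk'; apply/ffunP => i; apply/val_inj.
  have projf (u : {ffun 'I_d -> 'I_r.+1}) : proj sp (f u) 0 i = u i.
    rewrite raddf_sum summxE (bigD1 i)//= big1 ?addr0 => [|j ji].
      rewrite raddfMn sectK mulmxnE mxE !eqxx /=; exact: natz.
    by rewrite raddfMn sectK mulmxnE mxE eq_sym (negPf ji) andbF mul0rn.
  by apply/eqP; rewrite -eqz_nat -!projf kk'.
have f_ball : ([fset f k | k : {ffun 'I_d -> 'I_r.+1}] `<=`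
    fset_set (ball genS (\sum_i l i * r)))%fset.
  apply/fsubsetP => _ /imfsetP[k _ ->]; rewrite in_fset_set ?in_setE; last exact: finite_ball.
  apply/ballP; exists (\sum_i l i * k i)%N.
    by apply: leq_sum => i _; rewrite leq_mul2l -ltnS ltn_ord orbT.
  rewrite /f; elim/big_rec2: _ => [|i n g _ gn]; first exact/is_word_sum0.
  by apply: is_word_sumD gn; apply: is_word_sumMn.
rewrite big_distrl /=; apply: leq_trans (fsubset_leq_card f_ball).
by rewrite card_imfset// -cardE card_ffun !card_ord.
Qed.

(** The two bounds give r.+1 ^ d = O(r.+1 ^ d'), uniformly in r. *)
Lemma growth_rank_le (G G' : zmodType) (d d' : nat)
    (sp : splitting G d) (sp' : splitting G' d') (S : {fset G}) (S' : {fset G'})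
    (genS : monoid_generating S) (genS' : monoid_generating S') :
  (forall r, growth genS r = growth genS' r) -> (d <= d')%N.
Proof.
move=> eq_growth.
have [L lower] := growth_lower sp genS; have [C upper] := growth_upper sp' genS'.
rewrite leqNgt; apply/negP => d'd.
(* Since C * (L * r).+1 ^ d' <= C * L.+1 ^ d' * r.+1 ^ d', this radius makes the
   upper bound r * r.+1 ^ d', which is less than r.+1 ^ d'.+1. *)
pose r := (C * L.+1 ^ d')%N.
have : (r.+1 ^ d'.+1 <= r * r.+1 ^ d')%N.
  apply: leq_trans (_ : r.+1 ^ d <= _)%N; first by rewrite leq_pexp2l.
  apply: leq_trans (lower r) _; rewrite eq_growth; apply: leq_trans (upper _) _.
  rewrite /r -mulnA leq_mul2l -expnMn; apply/orP; right; apply: leq_expl.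
  rewrite -/r; lia.
by rewrite expnS leq_pmul2r ?expn_gt0// ltnn.
Qed.

(** * A generating set whose balls are boxes *)

Definition box (n N r : nat) : set 'rV[int]_n.+1 :=
  [set v | forall i, (`|v 0%R i| <= (if i == ord0 then N else 1) * r)%N].

Lemma finite_box (n N r : nat) : finite_set (@box n N r).
Proof.
pose K := (N.+1 * r)%N.
pose f (k : {ffun 'I_n.+1 -> 'I_(2 * K).+1}) : 'rV[int]_n.+1 :=
  \row_i (Posz (k i) - Posz K).
apply: (@sub_finite_set _ _ (range f)); last first.
  by apply: finite_image; apply: finite_finset.
move=> v vB.
have vK i : (`|v 0%R i| <= K)%N.
  by apply: leq_trans (vB i) _; rewrite leq_mul2r; apply/orP; right; case: ifP.
have shift i : (`|(v 0 i + Posz K)%R| < (2 * K).+1)%N by have := vK i; lia.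
exists [ffun i => Ordinal (shift i)] => //; apply/rowP => i; rewrite mxE ffunE /=.
move: (vK i); move: (v 0 i) => z zK; lia.
Qed.

Lemma box0 (n N : nat) (v : 'rV[int]_n.+1) : box N 0 v <-> v = 0.
Proof.
split=> [vB|-> i]; last by rewrite mxE.
by apply/rowP => i; have := vB i; rewrite muln0 leqn0 absz_eq0 mxE => /eqP.
Qed.

Section Carry.
Variables (G : zmodType) (n : nat) (sp : splitting G n.+1).

Let t := size (ker sp).
Let idx (g : G) : nat := index (tors_part sp g) (ker sp).

Lemma ker_size_gt0 : (0 < t)%N.
Proof.
by have := tors_part_ker sp 0; rewrite /t; case: (ker sp).
Qed.

Lemma idx_lt (g : G) : (idx g < t)%N.
Proof. by rewrite index_mem tors_part_ker. Qed.

Lemma idx_eq0 (g : G) : (idx g == 0%N) = (tors_part sp g == 0).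
Proof.
apply/eqP/eqP => [g0|g0].
  by rewrite -(nth_index 0 (tors_part_ker sp g)) -/(idx g) g0 ker_nth0.
rewrite /idx g0 -{1}(ker_nth0 sp).
by rewrite index_uniq ?ker_uniq//; apply: ker_size_gt0.
Qed.

(** Torsion parts act as digits in base t = size (ker sp) of the first coordinate,
which turns Z^n.+1 x T into Z^n.+1. *)
Definition carry (g : G) : 'rV[int]_n.+1 :=
  \row_i if i == ord0 then proj sp g 0 i * Posz t + Posz (idx g)
         else proj sp g 0 i.

Lemma carry0 : carry 0 = 0.
Proof.
have /eqP idx0 : idx 0 == 0%N by rewrite idx_eq0 /tors_part !raddf0 addr0.
by apply/rowP => i; rewrite !mxE raddf0 mxE idx0 mul0r addr0 if_same.
Qed.

(** Euclidean division by t recovers the first coordinate and the number of the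
torsion part. *)
Definition uncarry (v : 'rV[int]_n.+1) : G :=
  sect sp (\row_i if i == ord0 then (v 0%R i %/ Posz t)%Z else v 0 i) +
  nth 0 (ker sp) `|(v 0%R ord0 %% Posz t)%Z|.

Lemma carryK : cancel carry uncarry.
Proof.
move=> g; have := idx_lt g; have := ker_size_gt0 => t0 it.
rewrite /uncarry mxE eqxx modzMDl modz_small /=; last by lia.
rewrite nth_index ?tors_part_ker// addrC.
rewrite -[RHS](subrK (sect sp (proj sp g))); congr (_ + sect sp _).
apply/rowP => i; rewrite !mxE; case: eqP => // _.
by rewrite divzMDl ?divz_small ?addr0//; lia.
Qed.

Lemma uncarryK : cancel uncarry carry.
Proof.
move=> v; have t0 := ker_size_gt0.
have rt : (`|(v 0%R ord0 %% Posz t)%Z| < t)%N by lia.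
have kz : proj sp (nth 0 (ker sp) `|(v 0%R ord0 %% Posz t)%Z|) = 0.
  by apply/eqP; rewrite -mem_ker mem_nth.
have pE : proj sp (uncarry v) =
    \row_i if i == ord0 then (v 0%R i %/ Posz t)%Z else v 0 i.
  by rewrite raddfD sectK kz addr0.
apply/rowP => i; rewrite mxE pE mxE; case: eqP => // ->.
have -> : idx (uncarry v) = `|(v 0%R ord0 %% Posz t)%Z|%N.
  rewrite /idx /tors_part pE [X in X - _]addrC addrK index_uniq//.
  exact: ker_uniq.
by rewrite [RHS](divz_eq _ (Posz t)) gez0_abs//; lia.
Qed.

(** On the first coordinate a, the box condition is -mr <= a <= mr, except that
a = mr is allowed only for trivial torsion part: a nonzero digit would overflow
t m r. The boolean (tors_part sp g != 0), read as 0 or 1, expresses this. *)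
Lemma box_carryE (m r : nat) (g : G) :
  box (t * m) r (carry g) <->
  [/\ - Posz (m * r) <= proj sp g 0 ord0,
      proj sp g 0 ord0 + Posz (tors_part sp g != 0) <= Posz (m * r)
    & forall i, i != ord0 -> (`|proj sp g 0%R i| <= r)%N].
Proof.
have digit (a : int) (k M : nat) : (k < t)%N ->
    (`|(a * Posz t + Posz k)%R| <= t * M)%N =
    (- Posz M <= a) && (a + Posz (k != 0%N) <= Posz M).
  by move=> kt; apply/idP/andP; nia.
rewrite -idx_eq0; split=> [gB|[lo hi small] i].
  have := gB ord0; rewrite mxE eqxx -mulnA digit ?idx_lt// => /andP[-> ->].
  by split=> // i i0; have := gB i; rewrite mxE (negPf i0) mul1n.
rewrite mxE; case: eqP => [->|/eqP i0]; last by rewrite mul1n small.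
by rewrite -mulnA digit ?idx_lt// lo hi.
Qed.

(** Adding boxes. A sum attains the largest first coordinate only if both terms do,
and then both torsion parts vanish. Conversely, a summand s in the unit box is
split off from g by clamping every coordinate and giving s the whole torsion
part of g, so that the remainder has none. *)
Lemma box_carryS (m r : nat) (g : G) : (0 < m)%N ->
  box (t * m) r.+1 (carry g) <->
  exists s h, [/\ box (t * m) 1 (carry s), box (t * m) r (carry h) & g = s + h].
Proof.
move=> m0; split; last first.
  move=> [s [h [/box_carryE[slo shi ssm] /box_carryE[hlo hhi hsm] ->]]].
  apply/box_carryE; rewrite raddfD; split.
  - by rewrite mxE; lia.
  - rewrite mxE tors_partD.
    move: (tors_part sp s) (tors_part sp h) shi hhi => a b.
    by have [->|] := eqVneq a 0; rewrite ?add0r; case: (_ != 0); lia.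
  - by move=> i i0; rewrite mxE; have := ssm i i0; have := hsm i i0; lia.
move=> /box_carryE[lo hi small].
pose clamp (lb ub z : int) := Num.max lb (Num.min ub z).
(* The largest first coordinate m is available to s only if s has no torsion. *)
pose e := Posz (tors_part sp g != 0).
pose c : 'rV[int]_n.+1 := \row_i if i == ord0
  then clamp (- Posz m) (Posz m - e) (proj sp g 0 i)
  else clamp (-1) 1 (proj sp g 0 i).
pose s := sect sp c + tors_part sp g.
have tz : proj sp (tors_part sp g) = 0.
  by apply/eqP; rewrite -mem_ker tors_part_ker.
have ps : proj sp s = c by rewrite raddfD sectK tz addr0.
have ts : tors_part sp s = tors_part sp g.
  by rewrite /tors_part ps /s [X in X - _]addrC addrK.
have ph : proj sp (g - s) = proj sp g - c by rewrite raddfB ps.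
have th : tors_part sp (g - s) = 0.
  by apply: (addrI (tors_part sp s)); rewrite -tors_partD addrC subrK ts addr0.
exists s, (g - s); split; last by rewrite addrC subrK.
- apply/box_carryE; rewrite ps ts !mxE eqxx -/e; split.
  + by rewrite /clamp; lia.
  + by rewrite /clamp /e; lia.
  + by move=> i i0; rewrite mxE (negPf i0) /clamp; lia.
- apply/box_carryE; rewrite ph th !mxE !eqxx; split.
  + by rewrite /clamp /e; lia.
  + by rewrite /clamp /e; lia.
  + by move=> i i0; rewrite !mxE (negPf i0) /clamp; have := small i i0; lia.
Qed.

End Carry.

(** The generating set is the preimage of the unit box under [carry]; then the ball
of radius r is the preimage of the r-th box, and [carry] is a bijection. *)
Lemma box_growth (G : zmodType) (n : nat) (sp : splitting G n.+1) (m : nat) :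
  (0 < m)%N ->
  exists (S : {fset G}) (genS : monoid_generating S), forall r,
    growth genS r = #|` fset_set (@box n (size (ker sp) * m) r)|.
Proof.
move=> m0; pose N := (size (ker sp) * m)%N.
have N0 : (0 < N)%N by rewrite muln_gt0 ker_size_gt0.
have imE r : [set g | box N r (carry sp g)] = uncarry sp @` box N r.
  apply/seteqP; split=> [g gB|_ [v vB <-]]; last by rewrite /= uncarryK.
  by exists (carry sp g) => //; rewrite carryK.
pose S : {fset G} := fset_set [set g | box N 1 (carry sp g)].
have wordE r g : is_word_sum S r g <-> box N r (carry sp g).
  elim: r g => [|r IHr] g.
    rewrite is_word_sum0 box0 -(carry0 sp).
    by split=> [->//|/(can_inj (carryK sp))].
  split=> [/is_word_sumS[s [h [sS /IHr hB gE]]]|].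
    apply/box_carryS => //; exists s, h; split=> //.
    by move: sS; rewrite in_fset_set ?in_setE// imE; apply/finite_image/finite_box.
  move/(box_carryS sp r g m0) => [s [h [sB /IHr hB gE]]].
  apply/is_word_sumS; exists s, h; split=> //.
  by rewrite in_fset_set ?in_setE// imE; apply/finite_image/finite_box.
have genS : monoid_generating S.
  move=> g; exists (\sum_i `|carry sp g 0%R i|)%N; apply/wordE => i.
  rewrite (bigD1 i)//=; case: eqP => _; last by rewrite mul1n leq_addr.
  by apply: leq_trans (leq_addr _ _) (leq_pmull _ N0).
exists S, genS => r.
rewrite /growth; have -> : ball genS r = uncarry sp @` box N r.
  rewrite -imE; apply/seteqP; split=> g /=.
    move=> /ballP[k kr /wordE gB] i; apply: leq_trans (gB i) _.
    by rewrite leq_mul2l kr orbT.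
  by move=> gB; apply/ballP; exists r => //; apply/wordE.
rewrite fset_set_image; last exact: finite_box.
by rewrite card_imfset//; apply: can_inj (uncarryK sp).
Qed.

Theorem theorem1p4 (G G' : zmodType)
    (fgG : finitely_generated G) (fgG' : finitely_generated G')
    (rkG : rk G <> 0%N) (rkG' : rk G' <> 0%N) :
  (exists (S : {fset G}) (S' : {fset G'})
          (genS : monoid_generating S) (genS' : monoid_generating S'),
      forall r : nat, growth genS r = growth genS' r)
  <-> rk G = rk G'.
Proof.
have [sp] := fg_splitting fgG; have [sp'] := fg_splitting fgG'.
split=> [[S [S' [genS [genS' eq_growth]]]]|eq_rk].
  apply/eqP; rewrite eqn_leq (growth_rank_le sp sp' eq_growth).
  by apply: (growth_rank_le sp' sp (genS := genS') (genS' := genS)) => r.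
(* Each generating set uses the order of the other torsion group as its factor m,
   so both boxes have first half-width t t' r. *)
move: sp sp'; rewrite -eq_rk; case: (rk G) rkG => // n _ sp sp'.
have [S [genS growthS]] := box_growth sp (ker_size_gt0 sp').
have [S' [genS' growthS']] := box_growth sp' (ker_size_gt0 sp).
by exists S, S', genS, genS' => r; rewrite growthS growthS' mulnC.
Qed.
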